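(* Let $G$ be a finite abelian group (written additively), let $t \in \mathrm{Aut}(G)$, and let $A_t(G)$ be the Alexander quandle of $G$ with respect to $t$. Then the connected components of the Cayley graph $\Gamma_{A_t(G)}$ are complete directed graphs induced by the cosets of the subgroup $\mathrm{im}(\mathrm{id}-t) = \{g - t(g) : g \in G\}$ of $G$. Consequently, $\Gamma_{A_t(G)}$ is a disjoint union of $\frac{|G|}{|\mathrm{im}(\mathrm{id}-t)|}$ copies of the complete directed graph on $|\mathrm{im}(\mathrm{id}-t)|$ vertices.
   Context: A quandle is a set $Q$ with a binary operation $\rhd$ such that for all $x,y,z\in Q$: (1) $x\rhd x=x$; (2) for each $y$ the map $R_y(x)=x\rhd y$ is a bijection $Q\to Q$; (3) $(x\rhd y)\rhd z=(x\rhd z)\rhd(y\rhd z)$. For an additive abelian group $G$ and $t\in\mathrm{Aut}(G)$, the Alexander quandle $A_t(G)$ is the set $G$ with operation $x\rhd y=t(x)+(\mathrm{id}-t)(y)=t(x)+y-t(y)$. All graphs are directed graphs, with loops allowed and without multiple edges, so the edge set is a subset of $V\times V$. The (right) Cayley graph $\Gamma_Q$ of a quandle $Q$ is the directed graph with vertex set $Q$ and edge set $\{(x,x\rhd y): x,y\in Q\}$. A directed graph is connected if for every ordered pair of vertices $(u,v)$ there is a directed path from $u$ to $v$; the connected components are the maximal connected induced subgraphs. A directed graph is complete if for any two distinct vertices $a,b$ both edges $(a,b)$ and $(b,a)$ are present and there is exactly one loop at each vertex. *)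

(* Defs.v *)
From HB Require Import structures.
From mathcomp Require Import all_boot all_fingroup all_algebra.

Set Implicit Arguments.
Unset Strict Implicit.
Unset Printing Implicit Defensive.

Import GRing.Theory.
Local Open Scope ring_scope.

Record is_quandle (Q : Type) (op : Q -> Q -> Q) : Prop := IsQuandle {
  quandle_idem : forall x, op x x = x;
  quandle_bij : forall y, bijective (fun x => op x y);
  quandle_dist : forall x y z, op (op x y) z = op (op x z) (op y z) }.

Record finQuandle := FinQuandle {
  quandle_sort :> finType;
  quandle_op : quandle_sort -> quandle_sort -> quandle_sort;
  quandle_axioms : is_quandle quandle_op }.

(* Loops are allowed; representing the edge set as a relation rules out multiple
   edges. *)
Record digraph := Digraph {
  vertex :> finType;
  edge : rel vertex }.

Definition induced (D : digraph) (S : {set D}) : digraph :=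
  @Digraph {x : D | x \in S} (fun u v => edge (val u) (val v)).

Definition connected (D : digraph) : bool :=
  [forall u : D, forall v : D, connect (@edge D) u v].

(* The empty graph is vacuously [connected], hence the nonemptiness test. *)
Definition component (D : digraph) (S : {set D}) : bool :=
  maxset [pred C : {set D} | (C != set0) && connected (induced C)] S.

Definition complete (D : digraph) : Prop :=
  (forall a b : D, a != b -> edge a b /\ edge b a) /\ (forall a : D, edge a a).

Definition digraph_iso (D E : digraph) : Prop :=
  exists2 f : D -> E, bijective f & forall x y, edge (f x) (f y) = edge x y.

Definition complete_digraph (n : nat) : digraph :=
  @Digraph 'I_n (fun _ _ => true).

Lemma complete_digraphP n : complete (complete_digraph n).
Proof. by []. Qed.

Definition disjoint_copies (k : nat) (D : digraph) : digraph :=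
  @Digraph ('I_k * D)%type (fun u v => (u.1 == v.1) && edge u.2 v.2).

Definition cayley_digraph (Q : finQuandle) : digraph :=
  @Digraph Q (fun a b => [exists y : Q, b == quandle_op a y]).

(* A [finZmodType] is canonically a [finGroupType] for addition, so that
   [Aut [set: G]] is the group of additive automorphisms of [G]. *)
Section Alexander.

Variables (G : finZmodType) (t : {perm G}).
Hypothesis tA : t \in Aut [set: G].

Lemma Aut_addD : {morph t : x y / x + y}.
Proof. by move=> x y; apply: (morphicP (Aut_morphic tA)); rewrite inE. Qed.

Lemma Aut_add0 : t 0 = 0.
Proof. by apply: (addrI (t 0)); rewrite -Aut_addD !addr0. Qed.

Lemma Aut_addN : {morph t : x / - x}.
Proof.
by move=> x; apply: (addrI (t x)); rewrite -Aut_addD !subrr Aut_add0.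
Qed.

Definition alexander_op (x y : G) : G := t x + (y - t y).

Lemma alexander_opE x y : alexander_op x y = t (x - y) + y.
Proof. by rewrite /alexander_op Aut_addD Aut_addN addrA addrAC. Qed.

Lemma alexander_is_quandle : is_quandle alexander_op.
Proof.
split=> [x|y|x y z].
- by rewrite alexander_opE subrr Aut_add0 add0r.
- exists (fun z => (t^-1)%g (z - y) + y) => z; rewrite alexander_opE.
    by rewrite addrK permK subrK.
  by rewrite addrK permKV subrK.
- have tB u v : t (u - v) = t u - t v by rewrite Aut_addD Aut_addN.
  rewrite !alexander_opE.
  have -> : t (x - z) + z - (t (y - z) + z) = t (x - y).
    by rewrite opprD addrACA subrr addr0 -tB opprB addrA subrK.
  by rewrite -[t (x - y) + y - z]addrA (Aut_addD (t (x - y))) addrA.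
Qed.

Definition alexander : finQuandle := FinQuandle alexander_is_quandle.

Definition im_id_sub_set : {set G} := [set g - t g | g : G].

Lemma im_id_sub_group_set : group_set im_id_sub_set.
Proof.
apply/group_setP; split=> [|x y /imsetP[g _ ->] /imsetP[h _ ->]].
  by apply/imsetP; exists 0; rewrite // Aut_add0 subr0.
apply/imsetP; exists (g + h); rewrite // FinRing.zmodMgE Aut_addD opprD.
by rewrite addrACA.
Qed.

Definition im_id_sub : {group G} := Group im_id_sub_group_set.

End Alexander.

(* Main.v *)
(** Since [t x + y - t y - x = (y - x) - t (y - x)], there is an edge from [x] to
    [b] exactly when [b - x] lies in the image of [id - t].  Thus adjacency is
    already an equivalence relation, whose classes are the cosets of that image;
    they are cliques, and they all have the same size. *)
Require Import Defs.
From HB Require Import structures.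
From mathcomp Require Import all_boot all_fingroup all_algebra.

Set Implicit Arguments.
Unset Strict Implicit.
Unset Printing Implicit Defensive.

Import GRing.Theory.

Section EquivalenceDigraph.

Variable D : digraph.
Hypothesis eqvD : equivalence_rel (@edge D).

Let edge_refl : reflexive (@edge D).
Proof. by move=> x; case: (eqvD x x x). Qed.

Let edge_sym : symmetric (@edge D).
Proof.
have impl (x y : D) : edge x y -> edge y x.
  by case: (eqvD x y x) => xx /[apply] <-.
by move=> x y; apply/idP/idP; apply: impl.
Qed.

Let edge_trans : transitive (@edge D).
Proof.
move=> y x z xy; have [_ /(_ xy) ->] := eqvD x y z.
by [].
Qed.

(** A path inside [induced C] projects to a path of [D], and transitivity collapses it to a single
    edge; reflexivity covers the empty path. *)
Lemma connected_equiv_edge (C : {set D}) x y :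
  connected (induced C) -> x \in C -> y \in C -> edge x y.
Proof.
move=> /forallP conC xC yC.
have /forallP/(_ (exist _ y yC))/connectP[p] := conC (exist _ x xC).
have edge_path q (u : induced C) :
    path (@edge (induced C)) u q -> edge (val u) (val (last u q)).
  elim: q u => [|v q IHq] u //= /andP[uv /IHq].
  exact: edge_trans.
by move=> /edge_path/[swap] <-.
Qed.

Lemma connected_equiv_class x : connected (induced [set y : D | edge x y]).
Proof.
apply/forallP=> -[u xu]; apply/forallP=> -[v xv]; apply: connect1 => /=.
by rewrite !inE in xu xv; apply: edge_trans xv; rewrite edge_sym.
Qed.

(** Each class is connected, and a connected set lies in the class of any of its points. Maximality
    then forces equality in both directions; nonemptiness of a component supplies the representative
    [x]. *)
Lemma component_equiv (C : {set D}) :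
  component C <-> exists x : D, C = [set y | edge x y].
Proof.
split=> [/maxsetP[/= /andP[/set0Pn[x xC] conC] maxC] | [x ->]].
  exists x; symmetry; apply: maxC.
    by rewrite connected_equiv_class andbT; apply/set0Pn; exists x; rewrite inE.
  by apply/subsetP=> y yC; rewrite inE (connected_equiv_edge conC).
apply/maxsetP; split=> /= [|B /andP[_ conB] /subsetP sCB].
  by rewrite connected_equiv_class andbT; apply/set0Pn; exists x; rewrite inE.
apply/eqP; rewrite eqEsubset (introT subsetP sCB) andbT.
apply/subsetP=> y yB; rewrite inE (connected_equiv_edge conB) //.
by apply: sCB; rewrite inE.
Qed.

Lemma component_equiv_complete (C : {set D}) :
  component C -> complete (induced C).
Proof.
case/maxsetP=> /= /andP[_ conC] _.
by split=> [u v _|u]; [split|]; apply: (connected_equiv_edge conC); apply: valP.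
Qed.

End EquivalenceDigraph.

Section CosetCoordinates.

Local Open Scope group_scope.

Variables (gT : finGroupType) (H : {group gT}).

Lemma card_rcosetsT : #|rcosets H [set: gT]| = (#|gT| %/ #|H|)%N.
Proof. by rewrite -[#|rcosets _ _|]divgS ?subsetT // cardsT. Qed.

Lemma mem_rcosetsT x : H :* x \in rcosets H [set: gT].
Proof. by rewrite mem_rcosets mulSGid ?subsetT ?inE. Qed.

(** The first coordinate numbers the coset of [x], the second numbers the offset in [H] of [x] from
    the chosen representative of that coset. The membership proofs for [H :* 1] and [1] only show
    that the enumerated sets are nonempty. *)
Definition coset_coordinates (x : gT) : 'I_(#|gT| %/ #|H|)%N * 'I_#|H| :=
  (cast_ord card_rcosetsT (enum_rank_in (mem_rcosetsT 1) (H :* x)),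
   enum_rank_in (group1 H) (x * (repr (H :* x))^-1)).

Lemma coset_coordinates_fst x y :
  ((coset_coordinates x).1 == (coset_coordinates y).1) = (y \in H :* x).
Proof.
rewrite (inj_eq (@cast_ord_inj _ _ _)).
rewrite (inj_in_eq (@enum_rank_in_inj _ _ _ _ _ _)) ?mem_rcosetsT //.
by rewrite eq_sym; apply/eqP/idP => [<-|/rcoset_eqP]; rewrite ?rcoset_refl.
Qed.

Lemma coset_coordinates_bij : bijective coset_coordinates.
Proof.
apply: inj_card_bij => [x y exy|]; last first.
  (* By Lagrange the division is exact, so both sides have the same cardinality and injectivity
     suffices. *)
  rewrite card_prod !card_ord divnK //.
  by rewrite -cardsT cardSg ?subsetT.
have : y \in H :* x by rewrite -coset_coordinates_fst exy.
move/rcoset_eqP=> eH; move: exy => [_].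
(* [enum_rank_in] is injective only on the enumerated set, so both offsets must be shown to lie in
   [H]. The two cosets being equal, their representatives agree and cancel. *)
have memH z : z * (repr (H :* z))^-1 \in H.
  by rewrite -mem_rcoset rcoset_sym mem_repr_rcoset.
move/enum_rank_in_inj; rewrite !memH eH => /(_ isT isT); exact: mulIg.
Qed.

End CosetCoordinates.

Section AlexanderCayley.

Local Open Scope group_scope.

Variables (G : finZmodType) (t : {perm G}) (tA : t \in Aut [set: G]).

Lemma alexander_op_sub (x y : G) :
  (alexander_op t x y - x = (y - x) - t (y - x))%R.
Proof.
rewrite (alexander_opE tA) -(opprB y x) (Aut_addN tA) -addrA.
exact: addrC.
Qed.

Lemma edge_cayley_alexander (a b : G) :
  @edge (cayley_digraph (alexander tA)) a b = (b \in im_id_sub tA :* a).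
Proof.
rewrite mem_rcoset; apply/existsP/imsetP=> [[y /eqP->]|[g _ eg]].
  by exists (y - a)%R => //; apply: alexander_op_sub.
(* The witness is the solution [y] of [y - a = g]. *)
exists (g + a)%R; apply/eqP/(addIr (- a)%R).
by rewrite [RHS]alexander_op_sub addrK.
Qed.

Lemma equivalence_cayley_alexander :
  equivalence_rel (@edge (cayley_digraph (alexander tA))).
Proof.
move=> x y z; rewrite !edge_cayley_alexander rcoset_refl; split=> //.
by move/rcoset_eqP->.
Qed.

End AlexanderCayley.

Theorem theorem3p5 (G : finZmodType) (t : {perm G}) (tA : t \in Aut [set: G]) :
  [/\ forall C : {set G},
        component (D := cayley_digraph (alexander tA)) C
          = (C \in rcosets (im_id_sub tA) [set: G]),
      forall C : {set G},
        component (D := cayley_digraph (alexander tA)) C ->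
        complete (induced (D := cayley_digraph (alexander tA)) C)
    & digraph_iso (cayley_digraph (alexander tA))
        (disjoint_copies (#|G| %/ #|im_id_sub tA|)
           (complete_digraph #|im_id_sub tA|))].
Proof.
have eqvG := @equivalence_cayley_alexander G t tA.
have classE x : [set y : G | @edge (cayley_digraph (alexander tA)) x y]
    = (im_id_sub tA :* x)%g.
  by apply/setP=> y; rewrite inE edge_cayley_alexander.
split=> [C|C|].
- apply/idP/rcosetsP=> [/(component_equiv eqvG)[x ->]|[x _ ->]].
    by exists x; rewrite ?inE // -classE.
  by apply/(component_equiv eqvG); exists x; rewrite -classE.
- exact: (component_equiv_complete eqvG).
- exists (coset_coordinates (im_id_sub tA)); first exact: coset_coordinates_bij.
  (* Within a copy every edge is present, so adjacency in the target reduces to equality of first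
     coordinates, that is, to lying in the same coset. *)
  by move=> x y; rewrite edge_cayley_alexander -coset_coordinates_fst /= andbT.
Qed.
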